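(* If $n=2\nu$ is even, then $M\in\mathbb{R}^{n\times n}$ is an element of $N_n$ if and only if $$M=\mathcal{X}_n\begin{pmatrix}Y&V^T\\ W&Z\end{pmatrix}\mathcal{X}_n$$ for some $Y\in\mathbb{R}^{\nu\times\nu}$, some $V,W\in\mathbb{R}^{\nu\times\nu}$ such that $V^T\sigma_\nu=W^T\sigma_\nu=0_\nu$, and some $Z\in N_\nu$. If $n=2\nu+1$ is odd, then, with $\varepsilon=(-1)^\nu$, $M\in\mathbb{R}^{n\times n}$ is an element of $N_n$ if and only if $$M=\mathcal{X}_n\begin{pmatrix}Y+2\lambda\sigma_\nu\sigma_\nu^T&\varepsilon\sqrt2\,(\lambda\sigma_\nu-Y\sigma_\nu)&V^T\\ \varepsilon\sqrt2\,(\lambda\sigma_\nu-Y^T\sigma_\nu)^T&\lambda+2\,\sigma_\nu^TY\sigma_\nu&-\varepsilon\sqrt2\,(V\sigma_\nu)^T\\ W&-\varepsilon\sqrt2\,W\sigma_\nu&Z\end{pmatrix}\mathcal{X}_n$$ with arbitrary $V,W,Y,Z\in\mathbb{R}^{\nu\times\nu}$ and $\lambda\in\mathbb{R}$.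
   Context: $\sigma_n\in\mathbb{R}^n$ is the column vector with $j$th entry $(-1)^{j-1}$; $X^\bot=\{u\in\mathbb{R}^n\mid u^Tv=0\ (v\in X)\}$. For even $n$, $N_n$ is the space of matrices $M\in\mathbb{R}^{n\times n}$ with $\sum_{i\in\mathbb{Z}_n}(-1)^i(M_{i,j}+M_{i,j+1})=\sum_{i\in\mathbb{Z}_n}(-1)^i(M_{j,i}+M_{j+1,i})=0$ for all $j\in\mathbb{Z}_n=\mathbb{Z}/n\mathbb{Z}$ (indices modulo $n$). For odd $n$, $N_n=\{M\in\mathbb{R}^{n\times n}\mid\sigma_n^TMu=0=u^TM\sigma_n\ (u\in\{\sigma_n\}^\bot)\}$. $0_\nu\in\mathbb{R}^\nu$ is the null column vector; $\mathcal{I}_\nu$ is the $\nu\times\nu$ unit matrix; $\mathcal{J}_\nu=(\delta_{i,\nu+1-j})_{i,j=1}^\nu$ (ones on the antidiagonal, zeros elsewhere); and $$\mathcal{X}_n=\frac1{\sqrt2}\begin{pmatrix}\mathcal{I}_\nu&\mathcal{J}_\nu\\ \mathcal{J}_\nu&-\mathcal{I}_\nu\end{pmatrix}\ (n=2\nu),\qquad \mathcal{X}_n=\begin{pmatrix}\frac1{\sqrt2}\mathcal{I}_\nu&0_\nu&\frac1{\sqrt2}\mathcal{J}_\nu\\ 0_\nu^T&1&0_\nu^T\\ \frac1{\sqrt2}\mathcal{J}_\nu&0_\nu&-\frac1{\sqrt2}\mathcal{I}_\nu\end{pmatrix}\ (n=2\nu+1).$$ *)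

(* Defs.v *)
From HB Require Import structures.
From mathcomp Require Import all_boot all_order all_algebra.
From mathcomp Require Import classical_sets reals.

Set Implicit Arguments.
Unset Strict Implicit.
Unset Printing Implicit Defensive.

Import Order.TTheory GRing.Theory Num.Theory.

Local Open Scope classical_set_scope.
Local Open Scope ring_scope.

(* Throughout, the ordinal [i : 'I_n] stands for the index i + 1 of {1, ..., n}. *)

Definition sigma (R : realType) (n : nat) : 'cV[R]_n := \col_(j < n) (-1) ^+ j.

Definition orthogonal_complement (R : realType) (n : nat) (X : set 'cV[R]_n) :
    set 'cV[R]_n :=
  [set u | forall v, X v -> u^T *m v = 0].

(* [ordS] is the cyclic successor of 'I_n, i.e. j |-> j + 1 modulo n. The sign
   (-1)^i is well defined on Z/nZ because this is only used for even n. *)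
Definition N_even (R : realType) (n : nat) : set 'M[R]_n :=
  [set M | forall j : 'I_n,
    \sum_(i < n) (-1) ^+ i.+1 * (M i j + M i (ordS j)) = 0 /\
    \sum_(i < n) (-1) ^+ i.+1 * (M j i + M (ordS j) i) = 0].

Definition N_odd (R : realType) (n : nat) : set 'M[R]_n :=
  [set M | forall u : 'cV[R]_n, orthogonal_complement [set sigma R n] u ->
    (sigma R n)^T *m M *m u = 0 /\ u^T *m M *m sigma R n = 0].

Definition N (R : realType) (n : nat) : set 'M[R]_n :=
  if odd n then @N_odd R n else @N_even R n.

Definition antidiag_mx (R : realType) (nu : nat) : 'M[R]_nu :=
  \matrix_(i, j) (i == rev_ord j)%:R.

(* The 3 x 3 block matrix with the given blocks, listed row by row. *)
Definition block3_mx (R : realType) (m1 m2 m3 n1 n2 n3 : nat)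
    (A11 : 'M[R]_(m1, n1)) (A12 : 'M[R]_(m1, n2)) (A13 : 'M[R]_(m1, n3))
    (A21 : 'M[R]_(m2, n1)) (A22 : 'M[R]_(m2, n2)) (A23 : 'M[R]_(m2, n3))
    (A31 : 'M[R]_(m3, n1)) (A32 : 'M[R]_(m3, n2)) (A33 : 'M[R]_(m3, n3)) :
    'M[R]_(m1 + (m2 + m3), n1 + (n2 + n3)) :=
  block_mx A11             (row_mx A12 A13)
           (col_mx A21 A31) (block_mx A22 A23 A32 A33).

Definition X_even (R : realType) (nu : nat) : 'M[R]_(nu + nu) :=
  (1 / Num.sqrt 2) *:
    block_mx 1%:M                (antidiag_mx R nu)
             (antidiag_mx R nu)  (- 1%:M).

Definition X_odd (R : realType) (nu : nat) : 'M[R]_(nu + (1 + nu)) :=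
  let c : R := 1 / Num.sqrt 2 in
  block3_mx
    (c *: 1%:M)              (0 : 'cV[R]_nu)    (c *: antidiag_mx R nu)
    (0 : 'cV[R]_nu)^T        (1%:M : 'M[R]_1)   (0 : 'cV[R]_nu)^T
    (c *: antidiag_mx R nu)  (0 : 'cV[R]_nu)    (- (c *: 1%:M)).

(* Main.v *)
Require Import Defs.
From HB Require Import structures.
From mathcomp Require Import all_boot all_order all_algebra.
From mathcomp Require Import classical_sets reals.
From mathcomp Require Import ring.

Set Implicit Arguments.
Unset Strict Implicit.
Unset Printing Implicit Defensive.

Import Order.TTheory GRing.Theory Num.Theory.

Local Open Scope ring_scope.

(* For either parity, M lies in N_n iff sigma_n is both a right and a left
   eigenvector of M (the eigenvalues then agree, since sigma^T M sigma is
   n times each of them). The matrix X_n is a symmetric involution, so this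
   condition on M is equivalent to the same condition on X_n M X_n for the vector
   X_n sigma_n, which is a multiple of (0, sigma_nu) when n = 2 nu and equals
   (sqrt 2 sigma_nu, (-1)^nu, 0) when n = 2 nu + 1. Reading off the blocks gives
   both parametrisations; in the odd case the eigenvalue is n lambda. *)

(** * Membership in [N] as an eigenvector condition on [sigma] *)

Definition two_sided_eigenvector (R : realType) (n : nat) (M : 'M[R]_n) (v : 'cV[R]_n) : Prop :=
  exists c : R, M *m v = c *: v /\ M^T *m v = c *: v.

Lemma sigma_dot (R : realType) n : (sigma R n)^T *m sigma R n = n%:R%:M.
Proof.
apply/matrixP => i k; rewrite !ord1 !mxE eqxx mulr1n.
under eq_bigr => j _ do rewrite !mxE -expr2 sqrr_sign.
by rewrite sumr_const card_ord.
Qed.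

(** Decouples the two sides, so that each can be matched with one half of the definition of [N].
    Evaluating [sigma^T M sigma] in two ways gives [c n = d n]. *)
Lemma two_sided_eigenvector_sigmaE (R : realType) n (M : 'M[R]_n) :
  two_sided_eigenvector M (sigma R n) <->
  (exists c, M *m sigma R n = c *: sigma R n) /\
  (exists c, M^T *m sigma R n = c *: sigma R n).
Proof.
split=> [[c [h1 h2]]|[[c hc] [d hd]]]; first by split; exists c.
have [n0|n0] := posnP n.
  (* In dimension 0 there are no entries to compare, so any scalar serves. *)
  by exists 0; split; apply/matrixP => i k; have := ltn_ord i; rewrite [X in (_ < X)%N]n0.
suff cd : c = d by exists c; rewrite hc hd cd.
have : (sigma R n)^T *m (M *m sigma R n) = (M^T *m sigma R n)^T *m sigma R n.
  by rewrite trmx_mul trmxK mulmxA.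
rewrite hc hd [(d *: _)^T]linearZ /= -scalemxAl -scalemxAr sigma_dot.
move=> /matrixP/(_ 0 0); rewrite !mxE eqxx mulr1n.
by apply: mulIf; rewrite pnatr_eq0 -lt0n.
Qed.

(** The relation at [j] turns each entry into minus the next, so the first entry determines [w].
    Conversely, evenness makes the signs alternate also across the wrap-around from the last index
    to the first. *)
Lemma alternating_colP (R : realType) n (w : 'cV[R]_n) : ~~ odd n ->
  (forall j, w j 0 + w (ordS j) 0 = 0) <-> (exists c, w = c *: sigma R n).
Proof.
case: n w => [|n] w en.
  by split=> [_|_ []//]; exists 0; apply/matrixP => -[].
split=> [h|[c ->] j].
  exists (w 0 0).
  suff H k (lt_k : (k < n.+1)%N) : w (Ordinal lt_k) 0 = w 0 0 * (-1) ^+ k.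
    by apply/matrixP => -[i lt_i] k; rewrite ord1 H !mxE.
  elim: k lt_k => [|k IHk] lt_k.
    by rewrite mulr1; congr (w _ 0); apply: val_inj.
  have /(_ (Ordinal (ltnW lt_k))) := h; rewrite IHk.
  have -> : ordS (Ordinal (ltnW lt_k)) = Ordinal lt_k.
    by apply: val_inj; rewrite /= modn_small.
  by move/eqP; rewrite addrC addr_eq0 exprS mulN1r mulrN => /eqP.
rewrite !mxE -mulrDr -[(-1) ^+ ordS j]signr_odd /=.
have -> : odd (j.+1 %% n.+1) = ~~ odd j by rewrite odd_mod; last exact/negbTE.
by rewrite signrN signr_odd subrr mulr0.
Qed.

(** The double orthogonal complement of a line is the line: the part of [w] orthogonal to [sigma] is
    orthogonal to [w] by hypothesis, hence to itself, hence zero. *)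
Lemma sigma_orthP (R : realType) n (w : 'cV[R]_n) :
  (forall u : 'cV[R]_n, u^T *m sigma R n = 0 -> u^T *m w = 0) <->
  (exists c, w = c *: sigma R n).
Proof.
split=> [h|[c ->] u hu]; last by rewrite -scalemxAr hu scaler0.
have [n0|n0] := posnP n.
  by exists 0; apply/matrixP => i k; have := ltn_ord i; rewrite [X in (_ < X)%N]n0.
(* The coefficient of the orthogonal projection of [w] onto [sigma], as [sigma] has squared norm
   [n]. *)
pose c := ((sigma R n)^T *m w) 0 0 / n%:R.
exists c; apply/eqP; rewrite -subr_eq0; apply/eqP.
pose u := w - c *: sigma R n.
have nz : n%:R != 0 :> R by rewrite pnatr_eq0 -lt0n.
have us : u^T *m sigma R n = 0.
  rewrite /u linearB linearZ /= mulmxBl -scalemxAl sigma_dot.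
  rewrite -[w^T *m _]trmxK trmx_mul trmxK [(sigma R n)^T *m w]mx11_scalar.
  by rewrite tr_scalar_mx scale_scalar_mx /c divfK // subrr.
have uu : u^T *m u = 0 by rewrite {2}/u mulmxBr h // -scalemxAr us scaler0 subr0.
(* [u^T u] is a sum of squares, so its vanishing kills every entry of [u]. *)
apply/matrixP => i k; rewrite ord1 [RHS]mxE -/u; apply/eqP; rewrite -sqrf_eq0.
move/matrixP: uu => /(_ 0 0); rewrite !mxE => /eqP.
rewrite psumr_eq0 => [/allP/(_ i)|j _]; rewrite !mxE -?expr2 ?sqr_ge0 //.
by rewrite mem_index_enum; apply.
Qed.

(** For odd [n] the definition puts [M sigma] and [M^T sigma] in the double complement of [sigma];
    for even [n] it says that cyclically consecutive entries of these two vectors sum to zero. *)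
Lemma N_two_sided_eigenvector (R : realType) n (M : 'M[R]_n) :
  N M <-> two_sided_eigenvector M (sigma R n).
Proof.
rewrite two_sided_eigenvector_sigmaE /N; case: ifP => on.
  rewrite -!sigma_orthP; split=> [h|[h1 h2] u hu].
    split=> u hu; have [|h1 h2] := h u; try by move=> v ->.
      by rewrite mulmxA.
    by apply: trmx_inj; rewrite trmx_mul trmx_mul !trmxK trmx0.
  have {}hu := hu _ erefl; split; last by rewrite -mulmxA h1.
  by apply: trmx_inj; rewrite trmx_mul trmx_mul trmxK h2 ?trmx0.
rewrite -!alternating_colP ?on //.
(* The sign on the right comes from the exponent [i.+1] in [N_even], against [i] in [sigma]. Row
   sums use [A = M], column sums [A = M^T]. *)
have E (A : 'M[R]_n) j k :
    (A *m sigma R n) j 0 + (A *m sigma R n) k 0 =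
    - \sum_(i < n) (-1) ^+ i.+1 * (A j i + A k i).
  rewrite !mxE -big_split -sumrN; apply: eq_bigr => i _.
  by rewrite /= !mxE exprS; ring.
split=> [h|[h1 h2] j].
  split=> j; rewrite E; have [h1 h2] := h j; first by rewrite h2 oppr0.
  by under eq_bigr => i _ do rewrite !mxE; rewrite h1 oppr0.
split; apply/eqP; rewrite -oppr_eq0; apply/eqP.
  by rewrite -[RHS](h2 j) E; congr (- _); apply: eq_bigr => i _; rewrite !mxE.
by rewrite -[RHS](h1 j) E.
Qed.

(** * Transport of the condition by a symmetric involution and by scaling *)

Lemma two_sided_eigenvector_conj (R : realType) n (P B : 'M[R]_n) v :
  P *m P = 1%:M -> P^T = P ->
  two_sided_eigenvector B (P *m v) -> two_sided_eigenvector (P *m B *m P) v.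
Proof.
move=> PP PT [c [h1 h2]]; exists c; rewrite !trmx_mul PT !mulmxA.
by rewrite -!(mulmxA _ P v) -!mulmxA h1 h2 -!scalemxAr mulmxA PP mul1mx.
Qed.

(** The converse is the previous lemma applied to [P B P] and [P v], since conjugating twice by [P]
    gives back [B]. *)
Lemma two_sided_eigenvector_conjE (R : realType) n (P B : 'M[R]_n) v :
  P *m P = 1%:M -> P^T = P ->
  two_sided_eigenvector (P *m B *m P) v <-> two_sided_eigenvector B (P *m v).
Proof.
move=> PP PT; split; last exact: two_sided_eigenvector_conj.
have {2}-> : B = P *m (P *m B *m P) *m P.
  by rewrite !mulmxA PP mul1mx -mulmxA PP mulmx1.
by move=> h; apply: two_sided_eigenvector_conj; rewrite // mulmxA PP mul1mx.
Qed.

Lemma two_sided_eigenvectorZ (R : realType) n (B : 'M[R]_n) a v : a != 0 ->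
  two_sided_eigenvector B (a *: v) <-> two_sided_eigenvector B v.
Proof.
move=> a0; split=> -[c [h1 h2]]; exists c; last first.
  by rewrite -!scalemxAr h1 h2 !scalerA mulrC.
by split; apply: (scalerI a0); rewrite scalemxAr ?h1 ?h2 !scalerA mulrC.
Qed.

(** * The reversal matrix, the splitting of [sigma], and the constant [1 / sqrt 2] *)

Lemma tr_antidiag_mx (R : realType) n : (antidiag_mx R n)^T = antidiag_mx R n.
Proof.
by apply/matrixP => i j; rewrite !mxE eq_sym (can2_eq (@rev_ordK n) (@rev_ordK n)).
Qed.

Lemma mul_antidiag_mx (R : realType) n m (A : 'M[R]_(n, m)) :
  antidiag_mx R n *m A = \matrix_(i, j) A (rev_ord i) j.
Proof.
apply/matrixP => i j; rewrite !mxE (bigD1 (rev_ord i)) //= mxE rev_ordK eqxx mul1r.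
rewrite big1 ?addr0 // => k ki; rewrite mxE.
by rewrite -(can2_eq (@rev_ordK n) (@rev_ordK n)) eq_sym (negbTE ki) mul0r.
Qed.

Lemma antidiag_mxK (R : realType) n : antidiag_mx R n *m antidiag_mx R n = 1%:M.
Proof.
rewrite mul_antidiag_mx; apply/matrixP => i j.
by rewrite !mxE (inj_eq (@rev_ord_inj n)).
Qed.

(** Reversal moves exponent [i] to [n - 1 - i], which has the parity of [n + i + 1]. *)
Lemma antidiag_sigma (R : realType) n :
  antidiag_mx R n *m sigma R n = - ((-1) ^+ n) *: sigma R n.
Proof.
rewrite mul_antidiag_mx; apply/matrixP => i j; rewrite !mxE /=.
have -> : (-1) ^+ n = (-1) ^+ (n - i.+1) * (-1) ^+ i.+1 :> R by rewrite -exprD subnK.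
by rewrite exprS mulN1r mulrN opprK -mulrA -expr2 sqrr_sign mulr1.
Qed.

Lemma sigma_col_mx (R : realType) m n :
  sigma R (m + n) = col_mx (sigma R m) ((-1) ^+ m *: sigma R n).
Proof.
apply/matrixP => i j; rewrite mxE -(splitK i) /=.
by case: (split i) => k; rewrite ?col_mxEu ?col_mxEd !mxE //= exprD.
Qed.

Lemma sqr_inv_sqrt2 (R : realType) : (1 / Num.sqrt 2 : R) * (1 / Num.sqrt 2) = 2^-1.
Proof. by rewrite mul1r -invfM -expr2 sqr_sqrtr // ler0n. Qed.

Lemma inv_sqrt2_double (R : realType) : 1 / Num.sqrt 2 + 1 / Num.sqrt 2 = Num.sqrt 2 :> R.
Proof.
have s0 : Num.sqrt 2 != 0 :> R by rewrite sqrtr_eq0 -ltNge ltr0n.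
have s2 : Num.sqrt 2 * Num.sqrt 2 = 2 :> R by rewrite -expr2 sqr_sqrtr // ler0n.
by apply: (mulIf s0); rewrite mulrDl !divfK // s2.
Qed.

(** * The even case: [X_even] and 2 x 2 blocks *)

Lemma tr_X_even (R : realType) nu : (X_even R nu)^T = X_even R nu.
Proof. by rewrite linearZ /= tr_block_mx tr_antidiag_mx linearN /= !trmx1. Qed.

Lemma X_evenK (R : realType) nu : X_even R nu *m X_even R nu = 1%:M.
Proof.
rewrite /X_even -scalemxAl -scalemxAr scalerA sqr_inv_sqrt2 mulmx_block.
rewrite antidiag_mxK !(mul1mx, mulmx1, mulmxN, mulNmx) opprK subrr.
rewrite -mulr2n -[1%:M *+ 2]scaler_nat scale_block_mx scalerA mulVf ?pnatr_eq0 //.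
by rewrite scale1r scaler0 -scalar_mx_block.
Qed.

(** Up to sign, reversing one half of [sigma] gives the other: the two contributions cancel in the
    upper block and add up in the lower one. *)
Lemma X_even_sigma (R : realType) nu :
  X_even R nu *m sigma R (nu + nu) =
  (- (-1) ^+ nu * Num.sqrt 2) *: col_mx 0 (sigma R nu).
Proof.
rewrite sigma_col_mx /X_even -scalemxAl mul_block_col -!scalemxAr antidiag_sigma.
rewrite !mul1mx mulNmx mul1mx scalerA mulrN -expr2 sqrr_sign scaleN1r subrr.
rewrite scalerN -scaleNr -scalerDl !scale_col_mx !scaler0 scalerA.
by rewrite -[in RHS]inv_sqrt2_double; congr (col_mx _ (_ *: _)); ring.
Qed.

(** The upper half of the vector is zero, so only the right block column acts on it: [V^T] and [Z]
    for the matrix, [W^T] and [Z^T] for its transpose. *)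
Lemma two_sided_eigenvector_block_mx (R : realType) nu (Y V W Z : 'M[R]_nu) :
  two_sided_eigenvector (block_mx Y V^T W Z) (col_mx 0 (sigma R nu)) <->
  [/\ V^T *m sigma R nu = 0, W^T *m sigma R nu = 0 & two_sided_eigenvector Z (sigma R nu)].
Proof.
have E (A B C D : 'M[R]_nu) c :
    block_mx A B C D *m col_mx 0 (sigma R nu) = c *: col_mx 0 (sigma R nu) <->
    B *m sigma R nu = 0 /\ D *m sigma R nu = c *: sigma R nu.
  rewrite mul_block_col !mulmx0 !add0r scale_col_mx scaler0.
  by split=> [/eq_col_mx|[-> ->]].
split=> [[c]|[hV hW [c [h1 h2]]]]; last exists c; rewrite tr_block_mx !E //.
by case=> -[? ?] [? ?]; split=> //; exists c.
Qed.

(** * Calculus of 3 x 3 block matrices *)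

Lemma mul_block3_mx (R : realType) (m1 m2 m3 n1 n2 n3 p1 p2 p3 : nat)
    (A11 : 'M[R]_(m1, n1)) (A12 : 'M[R]_(m1, n2)) (A13 : 'M[R]_(m1, n3))
    (A21 : 'M[R]_(m2, n1)) (A22 : 'M[R]_(m2, n2)) (A23 : 'M[R]_(m2, n3))
    (A31 : 'M[R]_(m3, n1)) (A32 : 'M[R]_(m3, n2)) (A33 : 'M[R]_(m3, n3))
    (B11 : 'M[R]_(n1, p1)) (B12 : 'M[R]_(n1, p2)) (B13 : 'M[R]_(n1, p3))
    (B21 : 'M[R]_(n2, p1)) (B22 : 'M[R]_(n2, p2)) (B23 : 'M[R]_(n2, p3))
    (B31 : 'M[R]_(n3, p1)) (B32 : 'M[R]_(n3, p2)) (B33 : 'M[R]_(n3, p3)) :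
  block3_mx A11 A12 A13 A21 A22 A23 A31 A32 A33 *m
  block3_mx B11 B12 B13 B21 B22 B23 B31 B32 B33 =
  block3_mx
    (A11 *m B11 + (A12 *m B21 + A13 *m B31)) (A11 *m B12 + (A12 *m B22 + A13 *m B32))
    (A11 *m B13 + (A12 *m B23 + A13 *m B33))
    (A21 *m B11 + (A22 *m B21 + A23 *m B31)) (A21 *m B12 + (A22 *m B22 + A23 *m B32))
    (A21 *m B13 + (A22 *m B23 + A23 *m B33))
    (A31 *m B11 + (A32 *m B21 + A33 *m B31)) (A31 *m B12 + (A32 *m B22 + A33 *m B32))
    (A31 *m B13 + (A32 *m B23 + A33 *m B33)).
Proof.
rewrite /block3_mx mulmx_block mul_row_col mul_row_block mul_mx_row add_row_mx.
by rewrite mul_block_col mul_col_mx add_col_mx mulmx_block mul_col_row add_block_mx.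
Qed.

Lemma mul_block3_col (R : realType) (m1 m2 m3 n1 n2 n3 p : nat)
    (A11 : 'M[R]_(m1, n1)) (A12 : 'M[R]_(m1, n2)) (A13 : 'M[R]_(m1, n3))
    (A21 : 'M[R]_(m2, n1)) (A22 : 'M[R]_(m2, n2)) (A23 : 'M[R]_(m2, n3))
    (A31 : 'M[R]_(m3, n1)) (A32 : 'M[R]_(m3, n2)) (A33 : 'M[R]_(m3, n3))
    (v1 : 'M[R]_(n1, p)) (v2 : 'M[R]_(n2, p)) (v3 : 'M[R]_(n3, p)) :
  block3_mx A11 A12 A13 A21 A22 A23 A31 A32 A33 *m col_mx v1 (col_mx v2 v3) =
  col_mx (A11 *m v1 + (A12 *m v2 + A13 *m v3))
    (col_mx (A21 *m v1 + (A22 *m v2 + A23 *m v3))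
            (A31 *m v1 + (A32 *m v2 + A33 *m v3))).
Proof.
by rewrite /block3_mx mul_block_col mul_row_col mul_block_col mul_col_mx add_col_mx.
Qed.

Lemma tr_block3_mx (R : realType) (m1 m2 m3 n1 n2 n3 : nat)
    (A11 : 'M[R]_(m1, n1)) (A12 : 'M[R]_(m1, n2)) (A13 : 'M[R]_(m1, n3))
    (A21 : 'M[R]_(m2, n1)) (A22 : 'M[R]_(m2, n2)) (A23 : 'M[R]_(m2, n3))
    (A31 : 'M[R]_(m3, n1)) (A32 : 'M[R]_(m3, n2)) (A33 : 'M[R]_(m3, n3)) :
  (block3_mx A11 A12 A13 A21 A22 A23 A31 A32 A33)^T =
  block3_mx A11^T A21^T A31^T A12^T A22^T A32^T A13^T A23^T A33^T.
Proof. by rewrite /block3_mx !tr_block_mx tr_row_mx tr_col_mx. Qed.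

Lemma block3_mxP (R : realType) (m1 m2 m3 n1 n2 n3 : nat)
    (A : 'M[R]_(m1 + (m2 + m3), n1 + (n2 + n3))) :
  exists A11 A12 A13 A21 A22 A23 A31 A32 A33,
    A = block3_mx A11 A12 A13 A21 A22 A23 A31 A32 A33.
Proof.
exists (ulsubmx A), (lsubmx (ursubmx A)), (rsubmx (ursubmx A)).
exists (usubmx (dlsubmx A)), (ulsubmx (drsubmx A)), (ursubmx (drsubmx A)).
exists (dsubmx (dlsubmx A)), (dlsubmx (drsubmx A)), (drsubmx (drsubmx A)).
by rewrite /block3_mx hsubmxK vsubmxK !submxK.
Qed.

(** * The odd case: [X_odd] and its eigenvector equations *)

Lemma tr_X_odd (R : realType) nu : (X_odd R nu)^T = X_odd R nu.
Proof.
by rewrite /X_odd tr_block3_mx linearN /= !linearZ /= !trmxK !trmx1 tr_antidiag_mx !trmx0.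
Qed.

Lemma X_oddK (R : realType) nu : X_odd R nu *m X_odd R nu = 1%:M.
Proof.
rewrite /X_odd mul_block3_mx !trmx0.
rewrite !(mul0mx, mulmx0, mulmxN, mulNmx, addr0, add0r) opprK.
rewrite -!scalemxAl -!scalemxAr !scalerA !(mul1mx, mulmx1) antidiag_mxK.
rewrite sqr_inv_sqrt2 subrr -scalerDl.
have -> : 2^-1 + 2^-1 = 1 :> R by field.
by rewrite scale1r /block3_mx row_mx0 col_mx0 -!scalar_mx_block.
Qed.

(** The middle entry shifts the sign of the lower block of [sigma], so in contrast to the even case
    the upper contributions add up and the lower ones cancel. *)
Lemma X_odd_sigma (R : realType) nu :
  X_odd R nu *m sigma R (nu + (1 + nu)) =
  col_mx (Num.sqrt 2 *: sigma R nu) (col_mx ((-1) ^+ nu)%:M 0).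
Proof.
rewrite !sigma_col_mx scale_col_mx mul_block3_col !trmx0.
rewrite !(mul0mx, mulmx0, mulNmx, addr0, add0r) -!scalemxAl -!scalemxAr.
rewrite !(mul1mx, mulmx1) antidiag_sigma.
have e2 : (-1) ^+ nu * (-1) ^+ nu = 1 :> R by rewrite -expr2 sqrr_sign.
congr col_mx.
  rewrite !scalerA -scalerDl -[in RHS]inv_sqrt2_double; congr (_ *: _).
  by transitivity (1 / Num.sqrt 2 * (1 + (-1) ^+ nu * (-1) ^+ nu) : R); [ring|rewrite e2; ring].
congr col_mx; first by apply/matrixP => i j; rewrite !ord1 !mxE mulr1.
by rewrite !scalerA -scaleNr -scalerDl -[RHS](scale0r (sigma R nu)); congr (_ *: _); ring.
Qed.

(** Solves one block row of the eigenvector equation for its middle block, possible because the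
    middle entry of the vector is a sign and so its own inverse. *)
Lemma mul_row_X_odd_sigma (R : realType) m nu (A : 'M[R]_(m, nu)) (b : 'cV[R]_m)
    (C : 'M[R]_(m, nu)) (z : 'cV[R]_m) :
  A *m (Num.sqrt 2 *: sigma R nu) + (b *m ((-1) ^+ nu)%:M + C *m (0 : 'cV_nu)) = z <->
  b = (-1) ^+ nu *: z - ((-1) ^+ nu * Num.sqrt 2) *: (A *m sigma R nu).
Proof.
rewrite mulmx0 addr0 mul_mx_scalar -scalemxAr.
split=> [<-|->].
  by rewrite scalerDr !scalerA -expr2 sqrr_sign scale1r addrAC subrr add0r.
by rewrite scalerBr !scalerA mulrA -expr2 sqrr_sign mul1r scale1r addrC subrK.
Qed.

(** Each block row of the two eigenvector equations is solved for its middle block, which leaves the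
    four corner blocks free. Six equations arise, but the two for the centre coincide, so five are
    listed. *)
Lemma two_sided_eigenvector_block3_mx (R : realType) nu
    (A11 : 'M[R]_nu) (A12 : 'cV[R]_nu) (A13 : 'M[R]_nu)
    (A21 : 'rV[R]_nu) (A22 : 'M[R]_1) (A23 : 'rV[R]_nu)
    (A31 : 'M[R]_nu) (A32 : 'cV[R]_nu) (A33 : 'M[R]_nu) :
  let s := sigma R nu in
  let a := (-1) ^+ nu * Num.sqrt 2 in
  two_sided_eigenvector (block3_mx A11 A12 A13 A21 A22 A23 A31 A32 A33)
    (col_mx (Num.sqrt 2 *: s) (col_mx ((-1) ^+ nu)%:M 0)) <->
  exists c,
    [/\ A12 = a *: (c *: s - A11 *m s),
        A21 = a *: (c *: s - A11^T *m s)^T,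
        A22 = c%:M - a *: (A21 *m s),
        A23 = - (a *: (A13^T *m s)^T) &
        A32 = - (a *: (A31 *m s))].
Proof.
move=> s a.
have e2 : (-1) ^+ nu * (-1) ^+ nu = 1 :> R by rewrite -expr2 sqrr_sign.
have E B11 B12 B13 B21 B22 B23 B31 B32 (B33 : 'M[R]_nu) c :
    block3_mx B11 B12 B13 B21 B22 B23 B31 B32 B33
      *m col_mx (Num.sqrt 2 *: s) (col_mx ((-1) ^+ nu)%:M 0) =
    c *: col_mx (Num.sqrt 2 *: s) (col_mx ((-1) ^+ nu)%:M 0) <->
    [/\ B12 = a *: (c *: s - B11 *m s), B22 = c%:M - a *: (B21 *m s) &
        B32 = - (a *: (B31 *m s))].
  have -> : a *: (c *: s - B11 *m s) =
      (-1) ^+ nu *: (c *: (Num.sqrt 2 *: s)) - a *: (B11 *m s).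
    by rewrite scalerBr !scalerA /a mulrAC mulrA.
  have -> : c%:M - a *: (B21 *m s) =
      (-1) ^+ nu *: (c *: ((-1) ^+ nu)%:M) - a *: (B21 *m s) :> 'M_1.
    by rewrite !scale_scalar_mx mulrCA e2 mulr1.
  have -> : - (a *: (B31 *m s)) = (-1) ^+ nu *: (c *: 0) - a *: (B31 *m s).
    by rewrite !scaler0 sub0r.
  rewrite mul_block3_col !scale_col_mx.
  split=> [/eq_col_mx[h1 /eq_col_mx[h2 h3]]|[h1 h2 h3]].
    by split; apply/mul_row_X_odd_sigma; eassumption.
  by congr col_mx; last congr col_mx; apply/mul_row_X_odd_sigma.
have tr1 (D : 'M[R]_1) : D^T = D by rewrite [D]mx11_scalar tr_scalar_mx.
split=> -[c H]; exists c; move: H; rewrite tr_block3_mx !E.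
  case=> -[h12 h22 h32] [h21 _ h23]; split=> //; apply: trmx_inj.
    by rewrite h21 [RHS]linearZ /= trmxK.
  by rewrite h23 [RHS]linearN [in RHS]linearZ /= trmxK.
case=> h12 h21 h22 h23 h32; split; split=> //.
- by rewrite h21 [LHS]linearZ /= trmxK.
(* The centre equation of the transpose follows from that of the matrix: by [h12] and [h21], both
   [A12^T s] and [A21 s] equal [a (c s^T s - s^T A11 s)]. *)
- rewrite tr1 h22; congr (_ - a *: _); rewrite -[LHS]tr1 trmx_mul h21 h12.
  rewrite ![(a *: _)^T]linearZ /= trmxK -scalemxAl -!scalemxAr; congr (_ *: _).
  rewrite [(c *: s - A11 *m s)^T]linearB /= [(c *: s)^T]linearZ /= trmx_mul.
  by rewrite mulmxBl mulmxBr -scalemxAl -scalemxAr mulmxA.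
- by rewrite h23 [LHS]linearN [in LHS]linearZ /= trmxK.
Qed.

Theorem theorem7 (R : realType) (nu : nat) :
  (forall M : 'M[R]_(nu + nu),
     N M <->
     exists Y V W Z : 'M[R]_nu,
       [/\ V^T *m sigma R nu = 0,
           W^T *m sigma R nu = 0,
           N Z &
           M = X_even R nu *m block_mx Y V^T W Z *m X_even R nu])
  /\
  (forall M : 'M[R]_(nu + (1 + nu)),
     let eps : R := (-1) ^+ nu in
     let s : 'cV[R]_nu := sigma R nu in
     N M <->
     exists (V W Y Z : 'M[R]_nu) (lambda : R),
       M = X_odd R nu *m
           block3_mx
             (Y + (2 * lambda) *: (s *m s^T))
             ((eps * Num.sqrt 2) *: (lambda *: s - Y *m s))
             V^T
             ((eps * Num.sqrt 2) *: (lambda *: s - Y^T *m s)^T)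
             (lambda%:M + 2 *: (s^T *m Y *m s))
             (- ((eps * Num.sqrt 2) *: (V *m s)^T))
             W
             (- ((eps * Num.sqrt 2) *: (W *m s)))
             Z
           *m X_odd R nu).
Proof.
have conjP n (P A : 'M[R]_n) : P *m P = 1%:M -> A = P *m (P *m A *m P) *m P.
  by move=> PP; rewrite !mulmxA PP mul1mx -mulmxA PP mulmx1.
split=> [M|M eps s]; rewrite N_two_sided_eigenvector.
  have E B : two_sided_eigenvector (X_even R nu *m B *m X_even R nu) (sigma R (nu + nu)) <->
      two_sided_eigenvector B (col_mx 0 (sigma R nu)).
    rewrite two_sided_eigenvector_conjE ?X_evenK ?tr_X_even // X_even_sigma.
    rewrite two_sided_eigenvectorZ //.
    by rewrite mulf_neq0 ?oppr_eq0 ?signr_eq0 // sqrtr_eq0 -ltNge ltr0n.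
  split=> [|[Y [V [W [Z [hV hW hZ ->]]]]]]; last first.
    by rewrite E two_sided_eigenvector_block_mx; split=> //; apply/N_two_sided_eigenvector.
  rewrite (conjP _ _ M (X_evenK R nu)) E.
  (* The double transpose brings the upper right block into the form [V^T]. *)
  set B := _ *m M *m _; rewrite -[B]submxK -[ursubmx B]trmxK two_sided_eigenvector_block_mx.
  case=> hV hW /N_two_sided_eigenvector hZ.
  by exists (ulsubmx B), (ursubmx B)^T, (dlsubmx B), (drsubmx B).
have ss : s^T *m s = nu%:R%:M by exact: sigma_dot.
have aa : (eps * Num.sqrt 2) * (eps * Num.sqrt 2) = 2.
  by rewrite mulrACA -!expr2 sqrr_sign mul1r sqr_sqrtr ?ler0n.
(* With eigenvalue [n l], where [n = 1 + 2 nu], the rank-one term takes away [2 nu l] because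
   [s^T s = nu], and [l] remains. *)
have cancel_outer (Y : 'M[R]_nu) l : let c := l * (1 + nu + nu)%:R in
    c *: s - (Y + (2 * l) *: (s *m s^T)) *m s = l *: s - Y *m s.
  rewrite /= mulmxDl -scalemxAl -mulmxA ss mul_mx_scalar scalerA opprD.
  rewrite addrCA [RHS]addrC -scalerBl; congr (_ + _ *: _).
  by rewrite !natrD; ring.
(* Here the squared factor [eps * sqrt 2] gives 2, and again [n l - 2 nu l = l]. *)
have center (Y : 'M[R]_nu) l :
    (l * (1 + nu + nu)%:R)%:M -
      (eps * Num.sqrt 2) *: ((eps * Num.sqrt 2) *: (l *: s - Y^T *m s)^T *m s) =
    l%:M + 2 *: (s^T *m Y *m s).
  rewrite -scalemxAl scalerA aa [(l *: s - _)^T]linearB /= [(l *: s)^T]linearZ /=.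
  rewrite trmx_mul trmxK mulmxBl -scalemxAl ss scalerBr opprB addrCA addrC.
  by congr (_ + _); rewrite !scale_scalar_mx -raddfB !natrD; congr _%:M; ring.
have tr_outer (Y : 'M[R]_nu) l :
    (Y + (2 * l) *: (s *m s^T))^T = Y^T + (2 * l) *: (s *m s^T).
  by rewrite [LHS]linearD /= [(_ *: _)^T]linearZ /= trmx_mul trmxK.
have E B : two_sided_eigenvector (X_odd R nu *m B *m X_odd R nu) (sigma R (nu + (1 + nu))) <->
    two_sided_eigenvector B (col_mx (Num.sqrt 2 *: s) (col_mx eps%:M 0)).
  by rewrite two_sided_eigenvector_conjE ?X_oddK ?tr_X_odd // X_odd_sigma.
split=> [|[V [W [Y [Z [l ->]]]]]]; last first.
  rewrite E two_sided_eigenvector_block3_mx; exists (l * (1 + nu + nu)%:R).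
  by rewrite tr_outer !cancel_outer center trmxK.
rewrite (conjP _ _ M (X_oddK R nu)) E.
have [A11 [A12 [A13 [A21 [A22 [A23 [A31 [A32 [A33 ->]]]]]]]]] :=
  block3_mxP (X_odd R nu *m M *m X_odd R nu).
rewrite two_sided_eigenvector_block3_mx => -[c [h12 h21 h22 h23 h32]].
(* Inverts the parametrisation: [l] is the eigenvalue divided by [n], which is never zero for odd
   [n], and [Y] is the upper left block without its rank-one term. *)
pose l := c / (1 + nu + nu)%:R.
have cE : c = l * (1 + nu + nu)%:R by rewrite divfK // pnatr_eq0.
pose Y := A11 - (2 * l) *: (s *m s^T).
have A11E : A11 = Y + (2 * l) *: (s *m s^T) by rewrite subrK.
exists A13^T, A31, Y, A33, l; congr (_ *m _ *m _).
rewrite A11E tr_outer cE -/s !cancel_outer in h12 h21 h22.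
by rewrite -A11E trmxK h12 -center -h21 h22 h23 h32.
Qed.
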